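(* Let $\Gamma$ be a finite group. Given an element $x\in\Gamma_\infty$ of modified type $\lambda$, the number of elements appearing in a reduced expression of $x$ is $\|\lambda\|$.
   Context: $\Gamma_*$ is the set of conjugacy classes of $\Gamma$, and $c^0=\{1\}$. $S_n$ acts on $\Gamma^n$ by $\sigma(g_1,\dots,g_n)=(g_{\sigma^{-1}(1)},\dots,g_{\sigma^{-1}(n)})$, and $\Gamma_n=\Gamma^n\rtimes S_n$ with $(g,\sigma)(h,\tau)=(g\,\sigma(h),\sigma\tau)$. $\Gamma_n$ embeds in $\Gamma_{n+1}$ as $\Gamma_n\times1$, and $\Gamma_\infty=\bigcup_{n\ge1}\Gamma_n$. For $x=(g,\sigma)$ and a cycle $(i_1\cdots i_k)$ of $\sigma$ (fixed points are 1-cycles), the cycle-product is $g_{i_k}\cdots g_{i_1}$, well defined up to conjugacy. For a partition-valued function $\lambda$ on $\Gamma_*$, $\|\lambda\|=\sum_c|\lambda(c)|$. The type $\rho$ of $x\in\Gamma_n$: the number of parts of $\rho(c)$ equal to $i$ is the number of $i$-cycles of $\sigma$ with cycle-product in $c$. The modified type $\lambda$: $\lambda(c)=\rho(c)$ for $c\ne c^0$, and $\lambda(c^0)$ is obtained from $\rho(c^0)$ by subtracting 1 from every part (zeros discarded); it does not depend on $n$ with $x\in\Gamma_n$. For $g\in\Gamma$ and $i\ne j$, let $(i\stackrel{g}{\rightarrow}j)$ be the element $((g_1,g_2,\dots),(i,j))$ of $\Gamma_\infty$ with $g_j=g$, $g_i=g^{-1}$, $g_k=1$ for $k\ne i,j$.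 For $h\in\Gamma$, $h^{(i)}$ denotes $h$ in the $i$-th factor $\Gamma^{(i)}$ of $\Gamma^n\le\Gamma_n$. Every $x\in\Gamma_\infty$ is a product of elements of the form $(i\stackrel{g}{\rightarrow}j)$ and elements of the form $h^{(i)}$; such a product is called a reduced expression for $x$ if $x$ cannot be written as a product of fewer such elements. *)

(* Defs.v *)
From HB Require Import structures.
From mathcomp Require Import all_boot all_fingroup.
From mathcomp Require Import finmap.

Set Implicit Arguments.
Unset Strict Implicit.
Unset Printing Implicit Defensive.

Local Open Scope nat_scope.

Definition is_intpart (s : seq nat) : bool := sorted geq s && (0 \notin s).

Record intpart : Type :=
  Intpart { parts :> seq nat; partsP : is_intpart parts }.

HB.instance Definition _ := [isSub for parts].
HB.instance Definition _ := [Countable of intpart by <:].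

Lemma is_intpart_sort (s : seq nat) : is_intpart (sort geq [seq p <- s | 0 < p]).
Proof.
apply/andP; split; first by apply: sort_sorted => m n; exact: leq_total.
by rewrite mem_sort mem_filter ltnn.
Qed.

(* The partition whose parts are the nonzero entries of s, with multiplicity. *)
Definition mkpart (s : seq nat) : intpart := Intpart (is_intpart_sort s).

Lemma count_mkpart (s : seq nat) (k : nat) :
  0 < k -> count_mem k (mkpart s) = count_mem k s.
Proof.
move=> k_gt0; rewrite /mkpart /= (seq.permP (permEl (perm_sort _ _))) count_filter.
by apply: eq_count => p /=; case: eqP => // ->.
Qed.

Definition conjclass (gT : finGroupType) : Type :=
  {c : {set gT} | c \in classes [set: gT]}.

HB.instance Definition _ (gT : finGroupType) := Finite.on (conjclass gT).

Lemma class_one_mem (gT : finGroupType) : [set 1%g] \in classes [set: gT].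
Proof. by apply/imsetP; exists 1%g; rewrite ?inE ?class1G. Qed.

Definition class_one (gT : finGroupType) : conjclass gT :=
  exist _ [set 1%g] (class_one_mem gT).

Definition part_fun (gT : finGroupType) : Type := {ffun conjclass gT -> intpart}.

Definition part_norm (gT : finGroupType) (la : part_fun gT) : nat :=
  \sum_(c : conjclass gT) sumn (la c).

Record wreath (gT : finGroupType) (n : nat) : Type :=
  Wreath { wbase : {ffun 'I_n -> gT}; wperm : 'S_n }.

Section WreathGroup.
Variables (gT : finGroupType) (n : nat).
Implicit Types x y z : wreath gT n.

Definition wreath_code x := (wbase x, wperm x).
Definition wreath_decode (p : {ffun 'I_n -> gT} * 'S_n) := Wreath p.1 p.2.
Lemma wreath_codeK : cancel wreath_code wreath_decode. Proof. by case. Qed.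

HB.instance Definition _ := Finite.copy (wreath gT n) (can_type wreath_codeK).

Lemma wreathP x y :
  (forall i, wbase x i = wbase y i) -> (forall i, wperm x i = wperm y i) -> x = y.
Proof.
by case: x y => [g s] [h t] /= E F; congr Wreath; [apply/ffunP | apply/permP].
Qed.

Definition permute_base (s : 'S_n) (g : {ffun 'I_n -> gT}) :
  {ffun 'I_n -> gT} := [ffun i => g (s^-1%g i)].

(* Permutations compose from left to right in MathComp, (t * s) i = s (t i),
   so the composite of wperm x after wperm y is wperm y * wperm x. *)
Definition wreath_mul x y : wreath gT n :=
  Wreath [ffun i => wbase x i * permute_base (wperm x) (wbase y) i]%g
         (wperm y * wperm x)%g.

Definition wreath_one : wreath gT n := Wreath [ffun=> 1%g] 1%g.

Definition wreath_inv x : wreath gT n :=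
  Wreath [ffun i => (wbase x (wperm x i))^-1%g] (wperm x)^-1%g.

Lemma wreath_mulA : associative wreath_mul.
Proof.
move=> x y z; apply: wreathP => i /=; last by rewrite !permM.
by rewrite !ffunE invMg permM mulgA.
Qed.

Lemma wreath_mul1g : left_id wreath_one wreath_mul.
Proof.
move=> x; apply: wreathP => i /=; last by rewrite mulg1.
by rewrite !ffunE mul1g invg1 perm1.
Qed.

Lemma wreath_mulVg : left_inverse wreath_one wreath_inv wreath_mul.
Proof.
move=> x; apply: wreathP => i /=; last by rewrite mulgV.
by rewrite !ffunE invgK mulVg.
Qed.

HB.instance Definition _ :=
  Finite_isGroup.Build (wreath gT n) wreath_mulA wreath_mul1g wreath_mulVg.

End WreathGroup.

Section Types.
Variables (gT : finGroupType) (n : nat).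
Implicit Types (x : wreath gT n) (C : {set 'I_n}) (c : conjclass gT).

(* For the cycle (i_1 ... i_k) with i_1 = i, this is g_(i_k) * ... * g_(i_1). *)
Definition cycle_product x (i : 'I_n) : gT :=
  (\prod_(j <- rev (traject (wperm x) i #|porbit (wperm x) i|)) wbase x j)%g.

Lemma cycle_product_step x i :
  cycle_product x (wperm x i) = (cycle_product x i ^ (wbase x i)^-1)%g.
Proof.
rewrite /cycle_product; set s := wperm x.
have ->: porbit s (s i) = porbit s i by exact: (porbit_perm s 1).
have := trajectSr s i #|porbit s i|; rewrite iter_porbit trajectS.
have := card_porbit_neq0 s i; case: #|_| => // m _; rewrite [in RHS]trajectS.
rewrite trajectS => -[->]; rewrite rev_rcons rev_cons -cats1 big_cat big_cons.
by rewrite !big_cons big_nil /= mulg1 conjgE invgK !mulgA mulgK.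
Qed.

Lemma cycle_product_class x i j c : j \in porbit (wperm x) i ->
  (cycle_product x j \in val c) = (cycle_product x i \in val c).
Proof.
case/porbitP => m ->; have /imsetP[h _ ->] := valP c.
elim: m => [|m IHm]; first by rewrite expg0 perm1.
by rewrite expgSr permM cycle_product_step memJ_norm // groupV (subsetP (class_norm _ _)) ?inE.
Qed.

(* Cycles of a permutation are encoded by their supports. *)
Definition cycles_in_class x c : {set {set 'I_n}} :=
  [set C in porbits (wperm x) |
    [exists i in C, cycle_product x i \in val c]].

Lemma cycles_in_classE x c i :
  (porbit (wperm x) i \in cycles_in_class x c) = (cycle_product x i \in val c).
Proof.
rewrite inE imset_f //=; apply/existsP/idP => [[j /andP[/cycle_product_class->]]|] //.
by exists i; rewrite porbit_id.
Qed.

Definition wreath_type x : part_fun gT :=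
  [ffun c => mkpart [seq #|C| | C : {set 'I_n} <- enum (cycles_in_class x c)]].

Definition modify_type (rho : part_fun gT) : part_fun gT :=
  [ffun c => if c == class_one gT then mkpart [seq p.-1 | p <- rho c]
             else rho c].

Definition modified_type x : part_fun gT := modify_type (wreath_type x).

End Types.

Local Open Scope fset_scope.

(* The union of the groups wreath gT n (see wreath_incl_surj): a finitely supported function
   with a finitely supported permutation of nat (an injective function which
   fixes all but finitely many points is a permutation). *)
Record wreath_oo (gT : finGroupType) : Type := WreathOo {
  base_oo : {fsfun nat -> gT with 1%g};
  perm_oo : {fsfun nat -> nat};
  perm_ooP : fsinjectiveb perm_oo
}.

Section FinitaryPerm.
Implicit Types s t : {fsfun nat -> nat}.

Definition fsinv s : {fsfun nat -> nat} :=
  [fsfun k in finsupp s =>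
    nth k (finsupp s) (index k [seq s i | i <- finsupp s])].

Lemma fsinvK s : fsinjectiveb s -> cancel (fsinv s) s.
Proof.
move=> s_inj k; rewrite /fsinv fsfun_fun; case: ifPn => ks; last exact: fsfun_dflt.
have: k \in [seq s i | i <- finsupp s].
  have /imfset_eq_fsinjectiveP E := s_inj.
  by move: ks; rewrite -{1}E => /imfsetP[i /= i_s ->]; rewrite map_f.
move=> km; have lt: index k [seq s i | i <- finsupp s] < size (finsupp s).
  by rewrite -(size_map s) index_mem.
by rewrite -(nth_map k k) // nth_index.
Qed.

Lemma fsKinv s : fsinjectiveb s -> cancel s (fsinv s).
Proof.
move=> s_inj k; have /fsinjectiveP inj := s_inj.
by apply: inj; rewrite fsinvK.
Qed.

Lemma fsinv_inj s : fsinjectiveb s -> fsinjectiveb (fsinv s).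
Proof. by move=> s_inj; apply/fsinjectiveP; exact: can_inj (fsinvK s_inj). Qed.

Lemma fscomp_injb s t :
  fsinjectiveb s -> fsinjectiveb t -> fsinjectiveb (fsfun_comp s t).
Proof. by move=> /fsinjectiveP ? /fsinjectiveP ?; apply/fsinjectiveP/fscomp_inj. Qed.

Lemma fsid_inj : fsinjectiveb ([fsfun] : {fsfun nat -> nat}).
Proof. by apply/fsinjectiveP/fsfun0_inj. Qed.

Definition fstperm (i j : nat) : {fsfun nat -> nat} :=
  [fsfun [fsfun] with i |-> j, j |-> i].

Lemma fstpermE i j k :
  fstperm i j k = if k == i then j else if k == j then i else k.
Proof. by rewrite /fstperm !fsfun_withE fsfun0E. Qed.

Lemma fstperm_inj i j : fsinjectiveb (fstperm i j).
Proof.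
apply/fsinjectiveP; apply: inv_inj => k; rewrite !fstpermE.
by do ![case: eqP => //=; try congruence].
Qed.

End FinitaryPerm.

Section WreathOoGroup.
Variable gT : finGroupType.
Implicit Types x y z : wreath_oo gT.

Definition wreath_oo_code x :
    {p : {fsfun nat -> gT with 1%g} * {fsfun nat -> nat} | fsinjectiveb p.2} :=
  exist _ (base_oo x, perm_oo x) (perm_ooP x).
Definition wreath_oo_decode
    (p : {p : {fsfun nat -> gT with 1%g} * {fsfun nat -> nat} |
           fsinjectiveb p.2}) : wreath_oo gT :=
  WreathOo (val p).1 (valP p).
Lemma wreath_oo_codeK : cancel wreath_oo_code wreath_oo_decode.
Proof. by case=> g s s_inj; congr WreathOo; exact: bool_irrelevance. Qed.

HB.instance Definition _ := Choice.copy (wreath_oo gT) (can_type wreath_oo_codeK).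

Lemma wreath_ooP x y :
  base_oo x =1 base_oo y -> perm_oo x =1 perm_oo y -> x = y.
Proof.
case: x y => [g s sP] [h t tP] /= /fsfunP E /fsfunP F.
by rewrite E; case: _ / F tP => tP; congr WreathOo; exact: bool_irrelevance.
Qed.

Definition wreath_oo_mul x y : wreath_oo gT :=
  WreathOo
    [fsfun i in finsupp (base_oo x) `|` (perm_oo x @` finsupp (base_oo y)) =>
       (base_oo x i * base_oo y (fsinv (perm_oo x) i))%g]
    (fscomp_injb (perm_ooP x) (perm_ooP y)).

Definition wreath_oo_one : wreath_oo gT :=
  WreathOo [fsfun with 1%g] fsid_inj.

Definition wreath_oo_inv x : wreath_oo gT :=
  WreathOo
    [fsfun i in fsinv (perm_oo x) @` finsupp (base_oo x) =>
       ((base_oo x (perm_oo x i))^-1)%g]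
    (fsinv_inj (perm_ooP x)).

Lemma base_oo_mulE x y i :
  base_oo (wreath_oo_mul x y) i =
    (base_oo x i * base_oo y (fsinv (perm_oo x) i))%g.
Proof.
rewrite /= fsfun_fun inE; case: finsuppP => //= _; case: ifPn => // iN.
rewrite fsfun_dflt ?mulg1 //; apply: contra iN => iy.
by apply/imfsetP; exists (fsinv (perm_oo x) i); rewrite ?fsinvK ?perm_ooP.
Qed.

Lemma perm_oo_mulE x y i :
  perm_oo (wreath_oo_mul x y) i = perm_oo x (perm_oo y i).
Proof. exact: fscompE. Qed.

Lemma base_oo_invE x i :
  base_oo (wreath_oo_inv x) i = ((base_oo x (perm_oo x i))^-1)%g.
Proof.
rewrite /= fsfun_fun; case: ifPn => // iN.
rewrite fsfun_dflt ?invg1 //; apply: contra iN => ix.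
by apply/imfsetP; exists (perm_oo x i); rewrite ?fsKinv ?perm_ooP.
Qed.

Lemma wreath_oo_mulA : associative wreath_oo_mul.
Proof.
move=> x y z; apply: wreath_ooP => i; last by rewrite !perm_oo_mulE.
have E: fsinv (perm_oo (wreath_oo_mul x y)) i =
        fsinv (perm_oo y) (fsinv (perm_oo x) i).
  apply: (can_inj (fsKinv (perm_ooP (wreath_oo_mul x y)))).
  by rewrite fsinvK ?perm_ooP // perm_oo_mulE !fsinvK ?perm_ooP.
by rewrite !base_oo_mulE E mulgA.
Qed.

Lemma wreath_oo_mul1g : left_id wreath_oo_one wreath_oo_mul.
Proof.
move=> x; apply: wreath_ooP => i; last by rewrite perm_oo_mulE fsfun0E.
rewrite base_oo_mulE /= fsfun0E mul1g; congr (base_oo x _).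
by rewrite -{2}[i](fsinvK fsid_inj) fsfun0E.
Qed.

Lemma wreath_oo_mulg1 : right_id wreath_oo_one wreath_oo_mul.
Proof.
move=> x; apply: wreath_ooP => i; last by rewrite perm_oo_mulE fsfun0E.
by rewrite base_oo_mulE /= fsfun0E mulg1.
Qed.

Lemma wreath_oo_mulVg : left_inverse wreath_oo_one wreath_oo_inv wreath_oo_mul.
Proof.
move=> x; apply: wreath_ooP => i.
  have E: fsinv (perm_oo (wreath_oo_inv x)) i = perm_oo x i.
    apply: (can_inj (fsKinv (perm_ooP (wreath_oo_inv x)))).
    by rewrite fsinvK ?perm_ooP //= fsKinv ?perm_ooP.
  by rewrite base_oo_mulE E base_oo_invE mulVg /= fsfun0E.
by rewrite perm_oo_mulE /= fsKinv ?perm_ooP ?fsfun0E.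
Qed.

Lemma wreath_oo_mulgV : right_inverse wreath_oo_one wreath_oo_inv wreath_oo_mul.
Proof.
move=> x; apply: wreath_ooP => i.
  rewrite base_oo_mulE base_oo_invE fsinvK ?perm_ooP //.
  by rewrite mulgV /= fsfun0E.
by rewrite perm_oo_mulE /= fsinvK ?perm_ooP ?fsfun0E.
Qed.

HB.instance Definition _ :=
  isGroup.Build (wreath_oo gT) wreath_oo_mulA wreath_oo_mul1g wreath_oo_mulg1
    wreath_oo_mulVg wreath_oo_mulgV.

End WreathOoGroup.

Section Inclusion.
Variable gT : finGroupType.

Section OneSize.
Variable n : nat.
Implicit Types (x y : wreath gT n) (s : 'S_n).

Definition incl_perm s : {fsfun nat -> nat} :=
  [fsfun k in [fset i in iota 0 n] =>
    if (insub k : option 'I_n) is Some i then val (s i) else k].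

Lemma incl_permE s k :
  incl_perm s k = if (insub k : option 'I_n) is Some i then val (s i) else k.
Proof.
rewrite fsfun_fun !inE mem_iota add0n /=.
by case: insubP => [i -> //|/negPf ->].
Qed.

Lemma incl_perm_ord s (i : 'I_n) : incl_perm s i = s i.
Proof. by rewrite incl_permE valK. Qed.

Lemma incl_perm_ge s k : n <= k -> incl_perm s k = k.
Proof. by rewrite leqNgt incl_permE => /negPf kn; rewrite insubF. Qed.

Lemma incl_perm_inj s : fsinjectiveb (incl_perm s).
Proof.
apply/fsinjectiveP; apply: (@can_inj _ _ _ (incl_perm s^-1%g)) => k.
have [kn|nk] := ltnP k n; last by rewrite !incl_perm_ge.
by rewrite -[k]/(val (Ordinal kn)) !incl_perm_ord permK.
Qed.

Definition wreath_incl x : wreath_oo gT :=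
  WreathOo
    [fsfun k in [fset i in iota 0 n] =>
      if (insub k : option 'I_n) is Some i then wbase x i else 1%g]
    (incl_perm_inj (wperm x)).

Lemma base_incl_ord x (i : 'I_n) : base_oo (wreath_incl x) i = wbase x i.
Proof. by rewrite fsfun_fun !inE mem_iota add0n ltn_ord valK. Qed.

Lemma base_incl_ge x k : n <= k -> base_oo (wreath_incl x) k = 1%g.
Proof.
rewrite leqNgt => kn.
by rewrite fsfun_fun !inE mem_iota add0n (negPf kn).
Qed.

Lemma perm_incl_ord x (i : 'I_n) : perm_oo (wreath_incl x) i = wperm x i.
Proof. exact: incl_perm_ord. Qed.

Lemma perm_incl_ge x k : n <= k -> perm_oo (wreath_incl x) k = k.
Proof. exact: incl_perm_ge. Qed.

Lemma wreath_incl_inj : injective wreath_incl.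
Proof.
move=> x y E; apply: wreathP => i; first by rewrite -!base_incl_ord E.
apply: val_inj; have /= := congr1 (fun z => perm_oo z i) E.
by rewrite !incl_perm_ord.
Qed.

Lemma wreath_inclM : {morph wreath_incl : x y / (x * y)%g}.
Proof.
move=> x y; apply: wreath_ooP => k; have [kn|nk] := ltnP k n.
- rewrite -[k]/(val (Ordinal kn)) base_oo_mulE !base_incl_ord /= !ffunE.
  rewrite -[RHS]/(_ * _)%g; congr (_ * _)%g.
  rewrite -base_incl_ord; congr (base_oo _ _).
  apply: (can_inj (fsKinv (incl_perm_inj (wperm x)))).
  by rewrite fsinvK ?incl_perm_inj // incl_perm_ord permKV.
- rewrite base_oo_mulE !base_incl_ge ?mul1g //.
  rewrite -{1}(incl_perm_ge (wperm x) nk) fsKinv ?incl_perm_inj //.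
- by rewrite -[k]/(val (Ordinal kn)) perm_oo_mulE !perm_incl_ord permM.
- by rewrite perm_oo_mulE /= !incl_perm_ge.
Qed.

End OneSize.

(* The embedding as wreath gT n x 1: the new point is the last index. *)
Definition wreath_widen n (x : wreath gT n) : wreath gT n.+1 :=
  Wreath [ffun i => if unlift ord_max i is Some j then wbase x j else 1%g]
         (lift_perm ord_max ord_max (wperm x)).

Lemma wreath_incl_widen n (x : wreath gT n) :
  wreath_incl (wreath_widen x) = wreath_incl x.
Proof.
have Ev (i : 'I_n) : val i = val (lift ord_max i) by rewrite /= /bump leqNgt ltn_ord.
apply: wreath_ooP => k; have [kn|nk] := ltnP k n.
- rewrite -[k]/(val (Ordinal kn)) base_incl_ord Ev base_incl_ord ffunE.
  by rewrite liftK.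
- rewrite (base_incl_ge x nk); have [kn1|] := ltnP k n.+1; last exact: base_incl_ge.
  have ->: k = val (@ord_max n) by apply/eqP; rewrite eqn_leq nk -ltnS kn1.
  by rewrite base_incl_ord ffunE unlift_none.
- rewrite -[k]/(val (Ordinal kn)) perm_incl_ord Ev perm_incl_ord.
  by rewrite lift_perm_lift -Ev.
- rewrite (perm_incl_ge x nk); have [kn1|] := ltnP k n.+1; last exact: perm_incl_ge.
  have ->: k = val (@ord_max n) by apply/eqP; rewrite eqn_leq nk -ltnS kn1.
  by rewrite perm_incl_ord lift_perm_id.
Qed.

Lemma wreath_incl_surj (x : wreath_oo gT) :
  exists2 n, 0 < n & exists y : wreath gT n, x = wreath_incl y.
Proof.
pose S := finsupp (base_oo x) `|` finsupp (perm_oo x).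
pose n := (\max_(i <- S) i).+1.
have ltS i : i \in S -> i < n by move=> iS; rewrite ltnS; exact: leq_bigmax_seq.
have geb i : n <= i -> base_oo x i = 1%g.
  move=> ni; apply: fsfun_dflt; apply: contraL ni => iS.
  by rewrite -ltnNge ltS // inE iS.
have gep i : n <= i -> perm_oo x i = i.
  move=> ni; apply: fsfun_dflt; apply: contraL ni => iS.
  by rewrite -ltnNge ltS // inE iS orbT.
have inj : injective (perm_oo x) by apply/fsinjectiveP/perm_ooP.
have ltp i : i < n -> perm_oo x i < n.
  move=> i_n; rewrite ltnNge; apply/negP => /[dup] /gep /inj E.
  by rewrite E leqNgt i_n.
exists n => //.
have inj' : injective (fun i : 'I_n => Ordinal (ltp i (ltn_ord i))).
  by move=> i j [/inj] /val_inj.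
exists (Wreath [ffun i : 'I_n => base_oo x i] (perm inj')).
apply: wreath_ooP => k; have [kn|nk] := ltnP k n.
- by rewrite -[k]/(val (Ordinal kn)) base_incl_ord ffunE.
- by rewrite base_incl_ge ?geb.
- by rewrite -[k]/(val (Ordinal kn)) perm_incl_ord permE.
- by rewrite /= incl_perm_ge ?gep.
Qed.

End Inclusion.

Definition has_modified_type (gT : finGroupType) (x : wreath_oo gT)
    (la : part_fun gT) : Prop :=
  exists2 n, 0 < n &
    exists2 y : wreath gT n, x = wreath_incl y & la = modified_type y.

Section Expressions.
Variable gT : finGroupType.
Implicit Types (x : wreath_oo gT) (l : seq (wreath_oo gT)).

(* Meant for i != j. *)
Definition arrow (i j : nat) (g : gT) : wreath_oo gT :=
  WreathOo [fsfun [fsfun with 1%g] with i |-> (g^-1)%g, j |-> g]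
           (fstperm_inj i j).

Definition in_factor (i : nat) (h : gT) : wreath_oo gT :=
  WreathOo [fsfun [fsfun with 1%g] with i |-> h] fsid_inj.

Definition is_generator x : Prop :=
  (exists i j g, i != j /\ x = arrow i j g) \/ (exists i h, x = in_factor i h).

Definition expression l x : Prop :=
  (forall y, y \in l -> is_generator y) /\ (\prod_(y <- l) y)%g = x.

Definition reduced_expression l x : Prop :=
  expression l x /\ forall l', expression l' x -> size l <= size l'.

End Expressions.

(* Main.v *)
Require Import Defs.
From mathcomp Require Import all_boot all_fingroup.
From mathcomp Require Import finmap.

Set Implicit Arguments.
Unset Strict Implicit.
Unset Printing Implicit Defensive.

(** View x = (g, sigma) as acting on labelled points: moving k to sigma(k)
    multiplies on the left by the group element sitting at sigma(k), the gain of
    x at k. A gauge for x is a partial labelling phi of the points by pairs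
    (label, element of Gamma) which is invariant under x. Going once around a
    cycle multiplies the labels by a conjugate of the cycle-product, so a point
    of a cycle with nontrivial cycle-product cannot be labelled, whereas a cycle
    with trivial cycle-product can be labelled freely from one of its points.
    Hence, for x in Gamma_n with t cycles of trivial cycle-product, n - t is
    the least number of points outside which some gauge gives each point p the
    value (p, 1) ([gauge_trivial_cycles], [trivial_cycles_gauge]). It is also
    the norm of the modified type, since the sizes of all cycles add up to n
    and the modification removes 1 for each of these t cycles
    ([part_norm_modified_type]).

    The length of a reduced expression is the same minimum. Being a gauge for a
    generator is a single relation phi(j) = g phi(i), with i = j for h^(i).
    Starting from the labelling phi(p) = (p, 1) and imposing the relations of
    the k factors of an expression one after the other, each at the cost of
    eliminating one label, produces a common gauge of the factors, hence a gauge
    of the product, in which at most k points have lost their own label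
    ([expression_gauge]). Conversely, given a gauge for x with
    phi(p) = (p, 1) outside a list L, and a point i of L, multiplying x by the
    inverse of the generator moving i as x does makes i a fixed point with gain
    1, so that i may be removed from L; when L is empty x is the identity
    ([gauge_expression]). *)

(** * Gains and gauges *)

Section Gauges.
Local Open Scope group_scope.
Variable gT : finGroupType.
Implicit Types (x y a : wreath_oo gT) (l : seq (wreath_oo gT)).
Implicit Types (g h : gT) (i j k p q : nat) (L : seq nat).
Implicit Types (o : option (nat * gT)) (phi u : nat -> option (nat * gT)).

(** The gain of [x] at [k]: the group element met when [x] moves [k] to
    [perm_oo x k]. *)
Definition gain x k : gT := base_oo x (perm_oo x k).

Lemma perm_oo_inj x : injective (perm_oo x).
Proof. exact/fsinjectiveP/perm_ooP. Qed.

Lemma permM_oo x y k : perm_oo (x * y) k = perm_oo x (perm_oo y k).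
Proof. exact: perm_oo_mulE. Qed.

Lemma gainM x y k : gain (x * y) k = gain x (perm_oo y k) * gain y k.
Proof.
rewrite /gain permM_oo [LHS]base_oo_mulE; congr (_ * base_oo y _).
by rewrite fsKinv ?perm_ooP.
Qed.

Lemma perm_oo1 k : perm_oo (1 : wreath_oo gT) k = k.
Proof. exact: fsfun0E. Qed.

Lemma gain1 k : gain (1 : wreath_oo gT) k = 1.
Proof. exact: fsfun0E. Qed.

Lemma perm_gain_eq x y :
  perm_oo x =1 perm_oo y -> gain x =1 gain y -> x = y.
Proof.
move=> eqp eqg; apply: wreath_ooP => // k.
rewrite -[k](fsinvK (perm_ooP x)) -[LHS]/(gain x _) eqg /gain.
by rewrite -eqp.
Qed.

Lemma perm_arrow i j g k :
  perm_oo (arrow i j g) k = if k == i then j else if k == j then i else k.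
Proof. exact: fstpermE. Qed.

Lemma gain_arrow i j g k : i != j ->
  gain (arrow i j g) k = if k == i then g else if k == j then g^-1 else 1.
Proof.
move=> neq_ij; rewrite /gain perm_arrow /arrow /= !fsfun_withE fsfun0E.
case: (eqVneq k i) => [_|nki]; first by rewrite eq_sym (negPf neq_ij) eqxx.
case: (eqVneq k j) => [_|nkj]; first by rewrite eqxx.
by rewrite (negPf nki) (negPf nkj).
Qed.

Lemma perm_in_factor i h k : perm_oo (in_factor i h) k = k.
Proof. exact: fsfun0E. Qed.

Lemma gain_in_factor i h k : gain (in_factor i h) k = if k == i then h else 1.
Proof. by rewrite /gain perm_in_factor /in_factor /= fsfun_withE fsfun0E. Qed.

(** Left multiplication by [h] on the pointed set (nat x Gamma) + {None}. *)
Definition lact h o : option (nat * gT) := omap (fun z => (z.1, h * z.2)) o.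

Lemma lact1 o : lact 1 o = o.
Proof. by case: o => [[p h]|] //=; rewrite mul1g. Qed.

Lemma lactM g h o : lact (g * h) o = lact g (lact h o).
Proof. by case: o => [[p k]|] //=; rewrite mulgA. Qed.

(** A gauge for [x] is an [x]-invariant labelling of the points: a point carries
    either no label, or a label together with a phase in the group. *)
Definition gauge phi x : Prop :=
  forall k, phi (perm_oo x k) = lact (gain x k) (phi k).

(** A labelling is anchored off [L] when each point outside [L] carries itself
    as a label, with phase 1. *)
Definition anchored phi L : Prop := forall p, p \notin L -> phi p = Some (p, 1).

Lemma gauge1 phi : gauge phi 1.
Proof. by move=> k; rewrite perm_oo1 gain1 lact1. Qed.

Lemma gaugeM phi x y : gauge phi x -> gauge phi y -> gauge phi (x * y).
Proof. by move=> gx gy k; rewrite permM_oo gainM gx gy lactM. Qed.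

Lemma gauge_prod phi l :
  (forall y, y \in l -> gauge phi y) -> gauge phi (\prod_(y <- l) y).
Proof.
elim: l => [_|y l IHl gl]; first by rewrite big_nil; exact: gauge1.
rewrite big_cons; apply: gaugeM; first exact: gl (mem_head _ _).
by apply: IHl => z zl; apply: (gl z); rewrite inE zl orbT.
Qed.

(** * From expressions to gauges *)

(** Replace each label [p] by [u p], keeping track of phases; the label is erased
    if [u p = None]. *)
Definition relabel u phi k : option (nat * gT) :=
  obind (fun z => omap (fun w => (w.1, z.2 * w.2)) (u z.1)) (phi k).

Lemma relabel_lact u phi k j g :
  phi j = lact g (phi k) -> relabel u phi j = lact g (relabel u phi k).
Proof.
rewrite /relabel => ->; case: (phi k) => [[p h]|] //=.
by case: (u p) => [[q a]|] //=; rewrite mulgA.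
Qed.

Lemma gauge_relabel u phi x : gauge phi x -> gauge (relabel u phi) x.
Proof. by move=> gx k; apply: relabel_lact. Qed.

(** One relation between two points can be enforced at the cost of eliminating
    a single label: like one step of Gaussian elimination, the label is
    expressed in terms of another one, or erased. *)
Lemma relabel_solve phi i j g : exists u q,
  (forall p, p != q -> u p = Some (p, 1)) /\
  relabel u phi j = lact g (relabel u phi i).
Proof.
pose kill q p : option (nat * gT) := if p == q then None else Some (p, 1).
have killE q p : p != q -> kill q p = Some (p, 1) by rewrite /kill => /negPf->.
rewrite /relabel; case Ei: (phi i) => [[p a]|]; case Ej: (phi j) => [[q b]|] /=.
(* If both points carry the same label, the relation may force a nontrivial
   group element to fix its phase, so the label is erased. *)
- have [<-|npq] := eqVneq p q.
    exists (kill p), p; split; first exact: killE.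
    by rewrite /kill eqxx.
  exists (fun r => if r == q then Some (p, b^-1 * g * a) else Some (r, 1)), q.
  split=> [r /negPf -> //|]; rewrite eqxx (negPf npq) /=.
  by rewrite mulg1 !mulgA mulgV mul1g.
- by exists (kill p), p; split; [exact: killE | rewrite /kill eqxx].
- by exists (kill q), q; split; [exact: killE | rewrite /kill eqxx].
- by exists (kill 0), 0; split; first exact: killE.
Qed.

(** Being a gauge for a generator amounts to a single relation. *)
Lemma generator_gauge x : is_generator x -> exists i j g,
  forall phi, phi j = lact g (phi i) -> gauge phi x.
Proof.
case=> [[i [j [g [nij ->]]]]|[i [h ->]]].
  exists i, j, g => phi Ej k; rewrite perm_arrow gain_arrow //.
  case: eqP => [-> //|_]; case: eqP => [->|_]; last by rewrite lact1.
  by rewrite Ej -lactM mulVg lact1.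
exists i, i, h => phi Ei k; rewrite perm_in_factor gain_in_factor.
by case: eqP => [-> //|_]; rewrite lact1.
Qed.

Lemma generators_gauge l : (forall y, y \in l -> is_generator y) ->
  exists phi L,
    [/\ size L = size l, anchored phi L & forall y, y \in l -> gauge phi y].
Proof.
elim: l => [_|x l IHl gen].
  by exists (fun k => Some (k, 1)), [::]; split.
have [|phi [L [sL aL gl]]] := IHl.
  by move=> y yl; apply: gen; rewrite inE yl orbT.
have [i [j [g gx]]] := generator_gauge (gen x (mem_head _ _)).
have [u [q [uE uS]]] := relabel_solve phi i j g.
exists (relabel u phi), (q :: L); split=> [|p|y]; first by rewrite /= sL.
  rewrite inE negb_or => /andP[npq pL].
  by rewrite /relabel aL //= uE //= mulg1.
rewrite inE => /predU1P[->|yl]; first exact: gx.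
exact/gauge_relabel/gl.
Qed.

(** An expression of length k yields a gauge in which at most k points have lost
    their own label. *)
Lemma expression_gauge l x : expression l x ->
  exists phi L, [/\ size L = size l, anchored phi L & gauge phi x].
Proof.
case=> gen <-; have [phi [L [sL aL gl]]] := generators_gauge gen.
by exists phi, L; split=> //; apply: gauge_prod.
Qed.

(** * From gauges to expressions *)

(** Some generator moves [i] to [j] with gain [g]; the in-factor generators
    account for the case [i = j]. *)
Lemma generator_moving i j g : exists a, [/\ is_generator a,
  perm_oo a i = j /\ gain a i = g,
  i != j -> perm_oo a j = i /\ gain a j = g^-1 &
  forall k, k != i -> k != j -> perm_oo a k = k /\ gain a k = 1].
Proof.
have [<-|nij] := eqVneq i j.
  exists (in_factor i g); split=> [||//|k /negPf nki _]; first by right; exists i, g.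
    by rewrite perm_in_factor gain_in_factor eqxx.
  by rewrite perm_in_factor gain_in_factor nki.
exists (arrow i j g); split=> [||_|k /negPf nki /negPf nkj].
- by left; exists i, j, g.
- by rewrite perm_arrow gain_arrow ?eqxx.
- by rewrite perm_arrow gain_arrow // eq_sym (negPf nij) eqxx.
- by rewrite perm_arrow gain_arrow // nki nkj.
Qed.

(** Conversely, each point which does not carry its own label costs at most one
    generator. *)
Lemma gauge_expression L x phi : gauge phi x -> anchored phi L ->
  exists2 l, expression l x & size l = size L.
Proof.
elim: L x phi => [|i L IHL] x phi gx aL.
  exists [::] => //; split=> //; rewrite big_nil.
  have E k : Some (perm_oo x k, 1 : gT) = Some (k, gain x k).
    by rewrite -aL // gx aL //= mulg1.
  by apply: perm_gain_eq => k; rewrite ?perm_oo1 ?gain1; case: (E k).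
set j := perm_oo x i; set g := gain x i.
have [a [gen_a [ai gai] aj a_fix]] := generator_moving i j g.
(* After removing the factor a, the point i is fixed with gain 1, so it can be
   anchored to its own label. *)
pose phi' k := if k == i then Some (i, 1) else phi k.
have [||l [gen_l Dl] sl] := IHL (a^-1 * x) phi'; last first.
- exists (a :: l); last by rewrite /= sl.
  split=> [y|]; last by rewrite big_cons Dl mulKVg.
  by rewrite inE => /predU1P[->|/gen_l].
- move=> p pL; rewrite /phi'; case: eqP => [->//|/eqP npi].
  by rewrite aL // inE (negPf npi).
move=> k; set x' := a^-1 * x.
have Dxk : perm_oo x k = perm_oo a (perm_oo x' k) by rewrite -permM_oo mulKVg.
have Dgk : gain x k = gain a (perm_oo x' k) * gain x' k.
  by rewrite -gainM mulKVg.
rewrite /phi'; have [Em|nmi] := eqVneq (perm_oo x' k) i.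
  have Ek : k = i by apply: (@perm_oo_inj x); rewrite Dxk Em ai.
  rewrite Ek eqxx /=; congr (Some (_, _)).
  move: Dgk; rewrite Em gai Ek -/g -{1}[g]mulg1 => /mulgI <-.
  by rewrite mulg1.
have nki : k != i.
  by apply: contraNneq nmi => Ek; apply/eqP/(@perm_oo_inj a); rewrite -Dxk ai Ek.
rewrite (negPf nki); have [Em|nmj] := eqVneq (perm_oo x' k) j.
  have nij : i != j by rewrite -Em eq_sym.
  have [aji gaj] := aj nij.
  have := gx k; rewrite Dxk Dgk Em aji gaj => Ei.
  by rewrite /j gx Ei -lactM -/g mulKVg.
have [am gam] := a_fix _ nmi nmj.
by rewrite -{1}am -Dxk gx Dgk gam mul1g.
Qed.

End Gauges.

(** * Gauges and cycles with trivial cycle-product *)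

Section Cycles.
Local Open Scope group_scope.
Variables (gT : finGroupType) (n : nat).
Implicit Types (y : wreath gT n) (i j r : 'I_n) (C : {set 'I_n}).
Implicit Types (phi : nat -> option (nat * gT)) (L : seq nat).

(** The cycles of [y] with trivial cycle-product, encoded by their supports;
    they are called trivial below, whatever their length. *)
Definition trivial_cycles y : {set {set 'I_n}} :=
  cycles_in_class y (class_one gT).

Lemma trivial_cyclesE y i :
  (porbit (wperm y) i \in trivial_cycles y) = (cycle_product y i == 1).
Proof. by rewrite cycles_in_classE /= inE. Qed.

Lemma trivial_cycles_porbit y C :
  C \in trivial_cycles y -> exists i, C = porbit (wperm y) i.
Proof. by rewrite inE => /andP[/imsetP[i _ ->] _]; exists i. Qed.

(** The gain accumulated by [m] successive moves starting from [i]. *)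
Fixpoint path_gain y i m : gT :=
  if m is m'.+1 then wbase y (iter m (wperm y) i) * path_gain y i m' else 1.

Lemma path_gain_prod y i m :
  path_gain y i m = \prod_(j <- rev (traject (wperm y) (wperm y i) m)) wbase y j.
Proof.
elim: m => [|m IHm]; first by rewrite big_nil.
by rewrite trajectSr rev_rcons big_cons -IHm /= -iterSr.
Qed.

(** The gain accumulated once around a cycle is the cycle-product read from the
    next point, which is conjugate to the cycle-product itself. *)
Lemma path_gain_cycle y i :
  (path_gain y i #|porbit (wperm y) i| == 1) = (cycle_product y i == 1).
Proof.
have ->: path_gain y i #|porbit (wperm y) i| = cycle_product y (wperm y i).
  by rewrite path_gain_prod -(porbit_perm _ 1 i).
by rewrite cycle_product_step conjg_eq1.
Qed.

Lemma gain_incl y i : gain (wreath_incl y) i = wbase y (wperm y i).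
Proof. by rewrite /gain perm_incl_ord base_incl_ord. Qed.

Lemma gauge_iter y phi i m : gauge phi (wreath_incl y) ->
  phi (iter m (wperm y) i) = lact (path_gain y i m) (phi i).
Proof.
move=> gy; elim: m => [|m IHm] /=; first by rewrite lact1.
by rewrite lactM -IHm -gain_incl -perm_incl_ord gy.
Qed.

(** In an anchored gauge, each point of ['I_n] outside [L] lies on a trivial
    cycle, and distinct such points lie on distinct cycles. *)
Lemma gauge_trivial_cycles y phi L : gauge phi (wreath_incl y) ->
  anchored phi L -> n <= size L + #|trivial_cycles y|.
Proof.
move=> gy aL; pose A := [set i : 'I_n | val i \notin L].
have ALn : n <= size L + #|A|.
  have -> : size L + #|A| = #|A| + size L by rewrite addnC.
  rewrite -{1}[n]card_ord -(cardC (mem A)) leq_add2l.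
  rewrite cardE -(size_map val); apply: uniq_leq_size.
    by rewrite map_inj_uniq ?enum_uniq //; apply: val_inj.
  by move=> _ /mapP[i + ->]; rewrite mem_enum !inE negbK.
apply: leq_trans ALn _; rewrite leq_add2l.
have phiA i : i \in A -> phi i = Some (val i, 1) by rewrite inE => /aL.
rewrite -(card_in_imset (f := porbit (wperm y))) => [|i j iA jA /eqP].
  apply/subset_leq_card/subsetP => _ /imsetP[i iA ->].
  rewrite trivial_cyclesE -path_gain_cycle.
  have := gauge_iter i #|porbit (wperm y) i| gy.
  by rewrite iter_porbit phiA //= mulg1 => -[<-].
rewrite eq_porbit_mem => /porbitP[m Ei].
have := gauge_iter j m gy; rewrite -permX -Ei !phiA //= => -[E _].
exact: val_inj.
Qed.

(** A choice of one point in each cycle. *)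
Definition cycle_root y i : option 'I_n := [pick j in porbit (wperm y) i].

Lemma cycle_root_step y i : cycle_root y (wperm y i) = cycle_root y i.
Proof. by rewrite /cycle_root -(porbit_perm _ 1 i). Qed.

Lemma cycle_rootP y i :
  exists2 r, cycle_root y i = Some r & i \in porbit (wperm y) r.
Proof.
rewrite /cycle_root; case: pickP => [r ir|/(_ i)]; last by rewrite porbit_id.
by exists r => //; rewrite porbit_sym.
Qed.

Lemma cycle_root_root y i r : cycle_root y i = Some r ->
  porbit (wperm y) r = porbit (wperm y) i /\ cycle_root y r = Some r.
Proof.
move=> Er; have [r' Er' ir] := cycle_rootP y i.
have E : porbit (wperm y) r = porbit (wperm y) i.
  by move: Er ir; rewrite Er' => -[->]; rewrite -eq_porbit_mem eq_sym => /eqP.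
by split=> //; rewrite -Er /cycle_root E.
Qed.

Lemma path_gain_add y i m m' :
  path_gain y i (m + m') = path_gain y (iter m' (wperm y) i) m * path_gain y i m'.
Proof.
elim: m => [|m IHm]; first by rewrite mul1g.
by rewrite addSn /= IHm mulgA iterD.
Qed.

(** Along a trivial cycle the accumulated gain only depends on the endpoint. *)
Lemma path_gain_eq y i m m' : cycle_product y i = 1 ->
  iter m (wperm y) i = iter m' (wperm y) i -> path_gain y i m = path_gain y i m'.
Proof.
move/eqP; rewrite -path_gain_cycle; set d := #|_| => /eqP gd.
have d_gt0 : 0 < d by rewrite lt0n card_porbit_neq0.
have loop q : path_gain y i (q * d) = 1 /\ iter (q * d) (wperm y) i = i.
  elim: q => // q [IHg IHi]; rewrite mulSn path_gain_add IHg IHi gd mulg1.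
  by rewrite iterD IHi iter_porbit.
have mod_d k : path_gain y i k = path_gain y i (k %% d) /\
               iter k (wperm y) i = iter (k %% d) (wperm y) i.
  have [lg li] := loop (k %/ d).
  by rewrite {1 3}(divn_eq k d) addnC path_gain_add iterD lg li mulg1.
have [-> ->] := mod_d m; have [-> ->] := mod_d m'.
rewrite -!(nth_traject (wperm y) (n := d)) ?ltn_mod // => /eqP.
by rewrite nth_uniq ?size_traject ?ltn_mod ?uniq_traject_porbit // => /eqP ->.
Qed.

(** The point of a trivial cycle reached from its root by [m] moves gets the
    label of the root, with the accumulated gain as phase; points of the other
    cycles get no label. Points outside ['I_n] carry themselves as labels. *)
Definition root_gauge y k : option (nat * gT) :=
  if insub k is Some i then
    if cycle_root y i is Some r then
      if cycle_product y i == 1 then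
        let s := traject (wperm y) r #|porbit (wperm y) r| in
        Some (val r, path_gain y r (index i s))
      else None
    else None
  else Some (k, 1).

Lemma root_gaugeE y i r m : cycle_product y i = 1 ->
  cycle_root y i = Some r -> i = iter m (wperm y) r ->
  root_gauge y i = Some (val r, path_gain y r m).
Proof.
move=> ci Er Ei; rewrite /root_gauge valK Er ci eqxx.
have [Eo _] := cycle_root_root Er.
congr (Some (_, _)); apply: path_gain_eq.
  by apply/eqP; rewrite -trivial_cyclesE Eo trivial_cyclesE ci.
have ir : i \in traject (wperm y) r #|porbit (wperm y) r|.
  by rewrite -porbit_traject Eo porbit_id.
have := ir; rewrite -index_mem size_traject => lt_i.
by rewrite -Ei -[RHS](nth_index r ir) nth_traject.
Qed.

Lemma gauge_root_gauge y : gauge (root_gauge y) (wreath_incl y).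
Proof.
move=> k; have [kn|nk] := ltnP k n; last first.
  rewrite /gain !perm_incl_ge // base_incl_ge // lact1.
  by rewrite /root_gauge insubF // ltnNge nk.
rewrite -[k]/(val (Ordinal kn)); move: (Ordinal kn) => i {k kn}.
rewrite perm_incl_ord gain_incl.
have [r Er /porbitP[m Ei]] := cycle_rootP y i; rewrite permX in Ei.
have [ci|nci] := eqVneq (cycle_product y i) 1; last first.
  by rewrite /root_gauge !valK cycle_root_step Er cycle_product_step conjg_eq1 (negPf nci).
rewrite (root_gaugeE ci Er Ei) (root_gaugeE (r := r) (m := m.+1)) /= -?Ei //.
  by rewrite cycle_product_step ci conj1g.
by rewrite cycle_root_step.
Qed.

Lemma trivial_cycles_gauge y : exists phi L,
  [/\ gauge phi (wreath_incl y), anchored phi L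
    & size L + #|trivial_cycles y| <= n].
Proof.
pose A := [set i : 'I_n | (cycle_root y i == Some i) && (cycle_product y i == 1)].
exists (root_gauge y), [seq val i | i <- enum (~: A)]; split.
- exact: gauge_root_gauge.
- move=> k; have [kn|nk _] := ltnP k n; last first.
    by rewrite /root_gauge insubF // ltnNge nk.
  rewrite -[k]/(val (Ordinal kn)); move: (Ordinal kn) => i {k kn}.
  rewrite mem_map; last exact: val_inj.
  rewrite mem_enum !inE negbK => /andP[/eqP Ei /eqP ci].
  by rewrite (root_gaugeE (m := 0) ci Ei).
rewrite size_map -cardE -[leqRHS]card_ord -(cardC (mem A)) addnC.
rewrite -[X in _ <= _ + X]cardsE (_ : finset _ = ~: A); last first.
  by apply/setP => i; rewrite !inE.
rewrite leq_add2r.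
apply: leq_trans (leq_imset_card (porbit (wperm y)) A).
apply/subset_leq_card/subsetP => C CT.
have [i Ci] := trivial_cycles_porbit CT; rewrite {}Ci in CT *.
have [r Er _] := cycle_rootP y i; have [Eo Err] := cycle_root_root Er.
by apply/imsetP; exists r => //; rewrite inE Err eqxx -trivial_cyclesE Eo.
Qed.

(** * The norm of the modified type *)

Lemma sumn_mkpart (s : seq nat) : sumn (mkpart s) = sumn s.
Proof.
rewrite /mkpart /= !sumnE (perm_big _ (permEl (perm_sort _ _))) /=.
by rewrite big_filter big_mkcond; apply: eq_bigr => -[].
Qed.

Lemma mkpart_gt0 (s : seq nat) p : p \in (mkpart s : seq nat) -> 0 < p.
Proof. by rewrite /mkpart /= mem_sort mem_filter => /andP[]. Qed.

Lemma size_mkpart (s : seq nat) : all (fun p => 0 < p) s -> size (mkpart s) = size s.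
Proof. by move=> /all_filterP s_gt0; rewrite /= size_sort s_gt0. Qed.

Lemma sumn_predn (s : seq nat) : all (fun p => 0 < p) s ->
  sumn [seq p.-1 | p <- s] + size s = sumn s.
Proof.
elim: s => //= p s IHs /andP[p_gt0 s_gt0].
by rewrite -IHs // -addnA addnS -addSnnS prednK.
Qed.

Lemma sumn_wreath_type y c :
  sumn (wreath_type y c) = \sum_(C in cycles_in_class y c) #|C|.
Proof. by rewrite ffunE sumn_mkpart sumnE big_map big_enum. Qed.

Lemma sumn_modified_type y c :
  sumn (modified_type y c) + (c == class_one gT) * #|trivial_cycles y| =
  \sum_(C in cycles_in_class y c) #|C|.
Proof.
rewrite -sumn_wreath_type ffunE; case: eqP => [->|_]; last by rewrite addn0.
have pos : all (fun p => 0 < p)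
    [seq #|C| | C : {set 'I_n} <- enum (trivial_cycles y)].
  apply/allP => _ /mapP[C + ->]; rewrite mem_enum => /trivial_cycles_porbit[i ->].
  by rewrite lt0n card_porbit_neq0.
rewrite sumn_mkpart mul1n; set rho := wreath_type y _.
have -> : #|trivial_cycles y| = size rho.
  by rewrite /rho ffunE size_mkpart // size_map -cardE.
apply: sumn_predn; apply/allP => p; rewrite /rho ffunE; exact: mkpart_gt0.
Qed.

Lemma partition_porbits (s : 'S_n) : partition (porbits s) [set: 'I_n].
Proof.
have -> : porbits s = orbit 'P <[s]>%G @: [set: 'I_n].
  by apply/setP => C; apply/imsetP/imsetP => -[i _ ->]; exists i; rewrite ?porbit.unlock.
by apply: orbit_partition; apply/actsP => a _ i; rewrite !inE.
Qed.

(** The norm of the type is the number of points, and passing to the modified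
    type loses 1 for each cycle with trivial cycle-product. *)
Lemma part_norm_modified_type y :
  part_norm (modified_type y) + #|trivial_cycles y| = n.
Proof.
have -> : #|trivial_cycles y| =
    \sum_(c : conjclass gT) (c == class_one gT) * #|trivial_cycles y|.
  rewrite (bigD1 (class_one gT)) //= eqxx mul1n big1 ?addn0 // => c.
  by move/negPf->.
rewrite /part_norm -big_split /=.
under eq_bigr => c _ do rewrite sumn_modified_type big_mkcond.
rewrite exchange_big /= -[RHS]card_ord -[RHS]cardsT.
rewrite (card_partition (partition_porbits (wperm y))).
rewrite [RHS]big_mkcond; apply: eq_bigr => C _.
have [/imsetP[i _ ->]|nC] := ifPn; last first.
  by rewrite big1 // => c _; rewrite inE (negPf nC).
(* Each cycle belongs to exactly one conjugacy class. *)
have cP : cycle_product y i ^: [set: gT] \in classes [set: gT].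
  by rewrite mem_classes ?inE.
pose c0 : conjclass gT :=
  exist (fun c : {set gT} => c \in classes [set: gT]) _ cP.
rewrite (bigD1 c0) //= cycles_in_classE class_refl big1 ?addn0 //.
move=> c; rewrite cycles_in_classE; case: ifP => // ic /eqP[]; apply: val_inj => /=.
have /imsetP[h _ Dc] := valP c; move: ic; rewrite Dc => /class_eqP ->; exact: Dc.
Qed.

End Cycles.

Theorem lemma2p7 (gT : finGroupType) (x : wreath_oo gT) (la : part_fun gT)
    (hla : has_modified_type x la) :
  (exists l : seq (wreath_oo gT), reduced_expression l x) /\
  (forall l : seq (wreath_oo gT),
     reduced_expression l x -> size l = part_norm la).
Proof.
have [n _ [y Dx Dla]] := hla.
have norm_y := part_norm_modified_type y; rewrite -Dla in norm_y.
have lower l : expression l x -> part_norm la <= size l.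
  move=> /expression_gauge[phi [L [<- aL gx]]]; rewrite Dx in gx.
  have := gauge_trivial_cycles gx aL.
  by rewrite -{1}norm_y leq_add2r.
have [l xl sl] : exists2 l, expression l x & size l <= part_norm la.
  have [phi [L [gx aL leL]]] := trivial_cycles_gauge y.
  rewrite -Dx in gx; have [l xl sl] := gauge_expression gx aL.
  by exists l => //; rewrite sl -(leq_add2r #|trivial_cycles y|) norm_y.
split=> [|l' [xl' min_l']].
  by exists l; split=> // l' /lower; apply: leq_trans.
by apply/eqP; rewrite eqn_leq lower // (leq_trans (min_l' l xl)).
Qed.
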